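(* Let $0<\epsilon\le 1/256$, $s=\lfloor 1/(16\epsilon)\rfloor$, let $(\xi_i)_{1\le i\le s}$ be any admissible HLM realization, and let $d=d_s$, $G=\mathbb F_2^{\,n}$ and $A:=A_s$ be the associated top block dimension, group and top level set (all defined in the context). The integer $d$ is divisible by $8$; put $r:=d/8$. Then $$\operatorname{dist}_G\bigl(A,\mathcal S_r(G)\bigr)>\frac18\left(1-\left(\frac{\mathrm e}{4}\right)^r\right)>\frac1{16}.$$ Consequently, for every $0\le\eta\le1/16$, $$\operatorname{ldr}^*_\eta(A)\ge\frac d8\ge\operatorname{twr}(s-2),$$ and $d/8\ge(1/16)\log_2|G|$. More generally, for each fixed $\eta$ with $0\le\eta<1/8$, one has $\operatorname{ldr}^*_\eta(A)\ge d/8$ once $s$ is sufficiently large (depending on $\eta$).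
   Context: Here $\mathrm e$ is Euler's number. Tower function: $\operatorname{twr}(0)=1$, $\operatorname{twr}(r+1)=2^{\operatorname{twr}(r)}$. For $u,v\in\mathbb F_2^m$, $\langle u,v\rangle=\sum_j u_jv_j\in\mathbb F_2$. Ladders: a ladder of length $k$ in $A\subseteq G$ consists of $a_1,\dots,a_k,b_1,\dots,b_k\in G$ with $a_p+b_q\in A\iff p\le q$ for all $1\le p,q\le k$. $A$ is $k$-stable if it contains no ladder of length $k$; $\mathcal S_k(G)$ is the family of $k$-stable subsets of $G$. The ladder index $\operatorname{ldr}(A)$ is the largest $k$ for which $A$ contains a ladder of length $k$, with $\operatorname{ldr}(\emptyset)=0$. For $\eta\in[0,1]$, $\operatorname{ldr}^*_\eta(A)=\min\{\operatorname{ldr}(A\triangle B):B\subseteq G,\ |B|\le\eta|G|\}$. For a nonempty family $\mathcal C$ of subsets of $G$, $\operatorname{dist}_G(A,\mathcal C)=\min_{C\in\mathcal C}|A\triangle C|/|G|$. HLM construction. Fix $0<\epsilon\le1/256$ and $s=\lfloor1/(16\epsilon)\rfloor\ge16$. Define $d_1=1$, $D_0=0$, $D_i=\sum_{j\le i}d_j$, and $d_{i+1}=2^{D_i}$ for $i=1,2$, $d_{i+1}=2^{D_i-3}$ for $i\ge3$ (so $d_1,\dots,d_4=1,2,8,2^8$). Put $n=D_s$ and $G=\mathbb F_2^{\,n}$. Split coordinates into $s$ consecutive blocks, $x=(x^1,\dots,x^s)$ with $x^i\in\mathbb F_2^{d_i}$, and write $x^{<i}=(x^1,\dots,x^{i-1})\in\mathbb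 F_2^{D_{i-1}}$. An admissible HLM realization is a family of maps $\xi_i:\mathbb F_2^{D_{i-1}}\to\mathbb F_2^{d_i}$ ($1\le i\le s$), with images $\Xi_i=\xi_i(\mathbb F_2^{D_{i-1}})$, such that for every $i$: $\xi_i(u)\ne0$ for all $u$; $\Xi_i$ spans $\mathbb F_2^{d_i}$; $\xi_i$ is injective; for $i\le3$ the image $\Xi_i$ is a basis of $\mathbb F_2^{d_i}$; and for $i>3$ (where $|\Xi_i|=2^{D_{i-1}}=8d_i$) every subset of $\Xi_i$ containing at least $3|\Xi_i|/4$ vectors spans $\mathbb F_2^{d_i}$. The level sets are $A_i=\{x\in G:\langle x^i,\xi_i(x^{<i})\rangle=0\}$. *)

(* Defs.v *)
From HB Require Import structures.
From mathcomp Require Import all_boot all_order all_algebra.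
From mathcomp Require Import reals exp.

Set Implicit Arguments.
Unset Strict Implicit.
Unset Printing Implicit Defensive.

Import Order.TTheory GRing.Theory Num.Theory.

Fixpoint twr (r : nat) : nat := if r is r'.+1 then 2 ^ twr r' else 1.

Definition symdiff (T : finType) (A B : {set T}) : {set T} :=
  (A :\: B) :|: (B :\: A).

Section Ladders.
Variable G : finZmodType.
Implicit Types (A B C : {set G}) (F : {set {set G}}).

Definition has_ladder (k : nat) A : bool :=
  [exists a : {ffun 'I_k -> G}, exists b : {ffun 'I_k -> G},
     forall p : 'I_k, forall q : 'I_k,
       ((a p + b q)%R \in A) == (p <= q)].

Lemma has_ladderP k A :
  reflect (exists a b : 'I_k -> G,
             forall p q : 'I_k, (a p + b q)%R \in A <-> p <= q)
          (has_ladder k A).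
Proof.
apply: (iffP existsP) => [[a /existsP[b /forallP ab]]|[a [b ab]]].
  by exists a, b => p q; have /forallP/(_ q)/eqP-> := ab p.
exists (finfun a); apply/existsP; exists (finfun b).
apply/forallP => p; apply/forallP => q; rewrite !ffunE.
by apply/eqP; apply/idP/idP => /ab.
Qed.

Definition stable (k : nat) : {set {set G}} := [set A | ~~ has_ladder k A].

(* The range of the maximum loses nothing, by [has_ladder_leq_card]. *)
Definition ldr A : nat := \max_(k < #|G|.+1 | has_ladder k A) k.

Lemma has_ladder_leq_card k A : has_ladder k A -> k <= #|G|.
Proof.
case/has_ladderP=> a [b ab]; rewrite -[k in k <= _]card_ord.
apply: (leq_card a) => p q eq_a; apply/val_inj/eqP; rewrite eqn_leq.
by apply/andP; split; apply/ab; [rewrite eq_a|rewrite -eq_a]; apply/ab.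
Qed.

Lemma has_ladder0 A : has_ladder 0 A.
Proof. by apply/has_ladderP; exists (fun=> 0%R), (fun=> 0%R); case. Qed.

Lemma has_ladder_ldr A : has_ladder (ldr A) A.
Proof.
rewrite /ldr; apply: (big_ind (fun m => has_ladder m A)) => //.
  exact: has_ladder0.
by move=> x y; rewrite /maxn; case: ifP.
Qed.

Lemma leq_ldr k A : has_ladder k A -> k <= ldr A.
Proof.
move=> kA; have k_lt : k < #|G|.+1 by rewrite ltnS (has_ladder_leq_card kA).
exact: (leq_bigmax_cond (Ordinal k_lt)).
Qed.

Lemma set0_stable k : 0 < k -> set0 \in stable k.
Proof.
case: k => // k _; rewrite inE; apply/has_ladderP => -[a [b ab]].
by have /ab := leqnn (@ord0 k); rewrite inE.
Qed.

Variable R : realType.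

(* For 0 <= eta the set [set0] is admissible, and [ldr A] is the value there,
   so the neutral element does not affect the minimum. *)
Definition ldr_star (eta : R) A : nat :=
  \big[minn/ldr A]_(B : {set G} | (#|B|%:R <= eta * #|G|%:R)%R)
     ldr (symdiff A B).

(* The value is 1, the largest possible distance, when [F] is empty. *)
Definition dist A F : R :=
  \big[Num.min/1%R]_(C in F) (#|symdiff A C|%:R / #|G|%:R)%R.

Lemma ldr_star_min (eta : R) A : (0 <= eta)%R ->
  (exists2 B : {set G}, (#|B|%:R <= eta * #|G|%:R)%R &
     ldr_star eta A = ldr (symdiff A B)) /\
  (forall B : {set G}, (#|B|%:R <= eta * #|G|%:R)%R ->
     ldr_star eta A <= ldr (symdiff A B)).
Proof.
move=> eta0; split; last first.
  by move=> B hB; rewrite /ldr_star -minEnat -leEnat; exact: bigmin_le_cond.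
rewrite /ldr_star; elim/big_ind: _ => [|x y hx hy|B hB]; last by exists B.
  exists set0; first by rewrite cards0 mulr_ge0.
  by rewrite /symdiff setD0 set0D setU0.
by rewrite /minn; case: ifP.
Qed.

Lemma dist_min A F : F != set0 ->
  (exists2 C, C \in F & dist A F = (#|symdiff A C|%:R / #|G|%:R)%R) /\
  (forall C, C \in F -> (dist A F <= #|symdiff A C|%:R / #|G|%:R)%R).
Proof.
have le1 C : (#|symdiff A C|%:R / #|G|%:R <= 1 :> R)%R.
  rewrite ler_pdivrMr ?mul1r ?ler_nat ?max_card //.
  by rewrite ltr0n; apply/card_gt0P; exists 0%R.
have dist_le C : C \in F -> (dist A F <= #|symdiff A C|%:R / #|G|%:R)%R.
  by move=> CF; exact: bigmin_le_cond.
case/set0Pn=> C0 C0F; split=> //.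
have: dist A F = 1%R \/
    exists2 C, C \in F & dist A F = (#|symdiff A C|%:R / #|G|%:R)%R.
  rewrite /dist; elim/big_ind: _ => [|x y hx hy|C CF]; first by left.
    by rewrite /Num.min; case: ifP.
  by right; exists C.
case=> // d1; exists C0 => //; apply/eqP; rewrite eq_le dist_le //=.
by rewrite d1 le1.
Qed.

End Ladders.

(* [hlm_step i D] is the block dimension d_{i+1}, given D = D_i. *)
Definition hlm_step (i D : nat) : nat :=
  if i == 0 then 1 else if i <= 2 then 2 ^ D else 2 ^ (D - 3).

Fixpoint hlm_D (i : nat) : nat :=
  if i is i'.+1 then hlm_D i' + hlm_step i' (hlm_D i') else 0.

(* Blocks are numbered from 1; the value at 0 is a placeholder. *)
Definition hlm_d (i : nat) : nat :=
  if i is i'.+1 then hlm_step i' (hlm_D i') else 0.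

Lemma hlm_DE i : hlm_D i = \sum_(1 <= j < i.+1) hlm_d j.
Proof.
elim: i => [|i IHi]; first by rewrite big_geq.
by rewrite big_nat_recr //= -IHi.
Qed.

Lemma hlm_dS i : hlm_d i.+1 =
  if i == 0 then 1 else if i <= 2 then 2 ^ hlm_D i else 2 ^ (hlm_D i - 3).
Proof. by []. Qed.

Lemma hlm_D_mono i s : i <= s -> hlm_D i <= hlm_D s.
Proof.
move/subnKC <-; elim: (s - i) => [|k IHk]; first by rewrite addn0.
by rewrite addnS /= (leq_trans IHk) // leq_addr.
Qed.

Lemma hlm_D_block i : 0 < i -> hlm_D i = hlm_D i.-1 + hlm_d i.
Proof. by case: i. Qed.

Local Open Scope ring_scope.

Definition dot (m : nat) (u v : 'rV['F_2]_m) : 'F_2 :=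
  \sum_(j < m) u 0 j * v 0 j.

(* Coordinates a, ..., a + m - 1 of [x], counted from 0. The default 0 is
   never reached when a + m <= n, in particular not in [block] and [prefix]
   when 1 <= i <= s, since then D_{i-1} + d_i = D_i <= D_s. *)
Definition segment (n : nat) (x : 'rV['F_2]_n) (a m : nat) : 'rV['F_2]_m :=
  \row_(j < m) oapp (x 0) 0 (insub (a + j)%N).

Lemma segmentE (n : nat) (x : 'rV['F_2]_n) (a m : nat) (j : 'I_m)
    (lt_n : (a + j < n)%N) :
  segment x a m 0 j = x 0 (Ordinal lt_n).
Proof. by rewrite mxE insubT. Qed.

Definition block (s i : nat) (x : 'rV['F_2]_(hlm_D s)) : 'rV['F_2]_(hlm_d i) :=
  segment x (hlm_D i.-1) (hlm_d i).

Definition prefix (s i : nat) (x : 'rV['F_2]_(hlm_D s)) :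
    'rV['F_2]_(hlm_D i.-1) :=
  segment x 0 (hlm_D i.-1).

(* Only the maps with 1 <= i <= s matter in a realization with s levels. *)
Definition hlm_maps : Type :=
  forall i : nat, 'rV['F_2]_(hlm_D i.-1) -> 'rV['F_2]_(hlm_d i).

Definition hlm_image (xi : hlm_maps) (i : nat) : {set 'rV['F_2]_(hlm_d i)} :=
  [set xi i u | u : 'rV['F_2]_(hlm_D i.-1)].

Definition spans (m : nat) (S : {set 'rV['F_2]_m}) : Prop :=
  <<enum S>>%VS = fullv.

Definition admissible (s : nat) (xi : hlm_maps) : Prop :=
  forall i : nat, (1 <= i <= s)%N ->
  [/\ forall u, xi i u != 0,
      spans (hlm_image xi i),
      injective (xi i),
      (i <= 3)%N -> basis_of fullv (enum (hlm_image xi i))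
    & (3 < i)%N -> forall S : {set 'rV['F_2]_(hlm_d i)},
        S \subset hlm_image xi i ->
        (3 * #|hlm_image xi i| <= 4 * #|S|)%N -> spans S].

Definition level_set (s : nat) (xi : hlm_maps) (i : nat) :
    {set 'rV['F_2]_(hlm_D s)} :=
  [set x | dot (block i x) (xi i (prefix i x)) == 0].

(* Main.v *)
(* Write [x = (u, y)], where [u] is the prefix and [y] the top block, so that
   there are [8 d] values of [u] and [2 ^ d] of [y], and let [C] be r-stable.
   Call [y] good if [A] and [C] disagree at [(u, y)] for fewer than [d] values
   of [u]. Two good [y] with the same fibre of [C] satisfy the same more than
   [6 d] of the equations [<y, xi u> = 0], whose coefficient vectors span, so
   they are equal. The fibres of [C] shatter no set of size [r], because
   shattering produces a ladder of the form [(u_p, 0) + (0, y_q)]; Sauer-Shelah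
   on [8 d = 64 r] points then leaves fewer than [(64 e) ^ r = (e / 4) ^ r 2 ^ d]
   good [y], and each of the others costs [d] elements of the symmetric
   difference. *)
Require Import Defs.
From HB Require Import structures.
From mathcomp Require Import all_boot all_order all_algebra.
From mathcomp Require Import reals sequences exp.
From mathcomp Require Import ring lra zify.

Set Implicit Arguments.
Unset Strict Implicit.
Unset Printing Implicit Defensive.

Import Order.TTheory GRing.Theory Num.Theory.

(** * Shattering and the Sauer-Shelah lemma *)

Definition shattered (T : finType) (F : {set {set T}}) : {set {set T}} :=
  [set S : {set T} | [forall U : {set T},
     (U \subset S) ==> [exists E in F, E :&: S == U]]].

Lemma shatteredP (T : finType) (F : {set {set T}}) (S : {set T}) :
  reflect (forall U : {set T}, U \subset S -> exists2 E, E \in F & E :&: S = U)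
          (S \in shattered F).
Proof.
rewrite inE; apply: (iffP forallP) => [sh U US|sh U].
  have /implyP/(_ US)/existsP[E /andP[EF /eqP EU]] := sh U.
  by exists E.
apply/implyP=> /sh[E EF EU]; apply/existsP; exists E.
by rewrite EF EU eqxx.
Qed.

Lemma shattered_sub (T : finType) (F F' : {set {set T}}) :
  F \subset F' -> shattered F \subset shattered F'.
Proof.
move=> FF'; apply/subsetP=> S /shatteredP sh; apply/shatteredP=> U /sh[E EF EU].
by exists E => //; apply: (subsetP FF').
Qed.

(* Pajor's form of the Sauer-Shelah lemma. Split [F] according to membership of
   an element [x]; a set [S] shattered by both parts makes [x |: S] shattered by
   [F], although neither part shatters it. *)
Lemma card_leq_shattered (T : finType) (F : {set {set T}}) :
  #|F| <= #|shattered F|.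
Proof.
have [m] := ubnP #|F|; elim: m F => // m IHm F; rewrite ltnS => leFm.
have [le1|/card_gt1P[E1 [E2 [E1F E2F neqE]]]] := leqP #|F| 1.
  have [->|/set0Pn[E EF]] := eqVneq F set0; first by rewrite cards0.
  apply: leq_trans le1 _; rewrite card_gt0; apply/set0Pn; exists set0.
  apply/shatteredP=> U; rewrite subset0 => /eqP->.
  by exists E => //; rewrite setI0.
(* Two members of [F] differ at [x], so both parts are nonempty, hence smaller than [F], and
   induction applies to each. *)
have [x neqx] : exists x, (x \in E1) != (x \in E2).
  apply/existsP; apply: contraR neqE; rewrite negb_exists => /forallP eqE.
  by apply/eqP/setP=> x; apply/eqP; have:= eqE x; rewrite negbK.
pose F1 := [set E in F | x \in E]; pose F0 := [set E in F | x \notin E].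
have F1F : F1 \subset F by apply/subsetP=> E; rewrite inE => /andP[].
have F0F : F0 \subset F by apply/subsetP=> E; rewrite inE => /andP[].
have cardF : #|F| = #|F1| + #|F0|.
  rewrite -(cardsID [set E : {set T} | x \in E] F); congr (_ + _).
    by apply: eq_card => E; rewrite !inE.
  by apply: eq_card => E; rewrite !inE andbC.
have F1_gt0 : 0 < #|F1|.
  rewrite card_gt0; apply/set0Pn.
  by case: (boolP (x \in E1)) neqx => [xE1 _|_ xE2];
    [exists E1|exists E2]; rewrite inE ?E1F ?E2F //; case: (x \in E2) xE2.
have F0_gt0 : 0 < #|F0|.
  rewrite card_gt0; apply/set0Pn.
  by case: (boolP (x \in E1)) neqx => [xE1 xE2|xE1 _];
    [exists E2|exists E1]; rewrite inE ?E1F ?E2F //; case: (x \in E2) xE2.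
have IH1 : #|F1| <= #|shattered F1| by apply: IHm; lia.
have IH0 : #|F0| <= #|shattered F0| by apply: IHm; lia.
have x1 S : S \in shattered F1 -> x \notin S.
  move/shatteredP/(_ set0 (sub0set _))=> [E]; rewrite inE => /andP[_ xE] ES.
  by apply/negP=> xS; have := in_set0 x; rewrite -ES inE xE xS.
have x0 S : S \in shattered F0 -> x \notin S.
  move/shatteredP/(_ S (subxx S))=> [E]; rewrite inE => /andP[_ xE] ES.
  by rewrite -ES inE (negPf xE).
pose J := [set x |: S | S in shattered F1 :&: shattered F0].
have cardJ : #|J| = #|shattered F1 :&: shattered F0|.
  apply: card_in_imset => S S1 /setIP[/x1 xS _] /setIP[/x1 xS1 _].
  by move/(congr1 (fun S => S :\ x)); rewrite !setU1K.
have subJ : J \subset shattered F.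
  apply/subsetP=> _ /imsetP[S /setIP[sh1 sh0] ->]; apply/shatteredP=> U US.
  have xS := x1 _ sh1.
  have UxS : U :\ x \subset S by rewrite subDset.
  case: (boolP (x \in U)) => xU.
    have /shatteredP/(_ _ UxS)[E] := sh1; rewrite inE => /andP[EF xE] EU.
    exists E => //; rewrite setIUr EU.
    have -> : E :&: [set x] = [set x] by apply/setIidPr; rewrite sub1set.
    exact: setD1K.
  have /shatteredP/(_ _ UxS)[E] := sh0; rewrite inE => /andP[EF xE] EU.
  exists E => //; rewrite setIUr EU.
  have -> : E :&: [set x] = set0.
    by apply/setP=> y; rewrite !inE; case: eqP => [->|_]; rewrite ?(negPf xE) ?andbF.
  rewrite set0U; apply/setP=> y; rewrite !inE.
  by case: eqP => // ->; rewrite (negPf xU).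
have disJ : [disjoint J & shattered F1 :|: shattered F0].
  rewrite disjoint_subset; apply/subsetP=> _ /imsetP[S _ ->].
  rewrite unfold_in /= in_setU; apply/negP=> /orP[]; [move/x1|move/x0]; by rewrite setU11.
have: #|J :|: (shattered F1 :|: shattered F0)| <= #|shattered F|.
  apply: subset_leq_card; rewrite !subUset subJ.
  by rewrite !shattered_sub.
have := cardsUI J (shattered F1 :|: shattered F0).
have /eqP-> : J :&: (shattered F1 :|: shattered F0) == set0.
  by rewrite setI_eq0.
have := cardsUI (shattered F1) (shattered F0).
rewrite cards0 addn0 => UI UJ; rewrite UJ cardJ addnC UI cardF.
exact: leq_trans (leq_add IH1 IH0).
Qed.

(** Enumerate [S] as [u_0, u_1, ...]; shattering cuts out each initial segment of the enumeration,
    and [y_q] is chosen so that [c (y_q)] cuts out the one ending at [u_q]. *)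
Lemma shattered_half_graph (T X : finType) (c : X -> {set T}) (Y : {set X})
    (S : {set T}) (r : nat) :
  r <= #|S| -> S \in shattered (c @: Y) ->
  exists u (y : 'I_r -> X), forall p q : 'I_r, (u p \in c (y q)) = (p <= q).
Proof.
move=> rS /shatteredP sh; pose u (p : 'I_r) := enum_val (widen_ord rS p).
have inju : injective u by move=> p q /enum_val_inj/(congr1 val)/= /val_inj.
have ex (q : 'I_r) : exists y, forall p, (u p \in c y) = (p <= q).
  have /sh[_ /imsetP[y _ ->] yU] : [set u p | p : 'I_r & p <= q] \subset S.
    by apply/subsetP=> _ /imsetP[p _ ->]; apply: enum_valP.
  exists y => p; have := in_setI (u p) (c y) S; rewrite yU enum_valP andbT => <-.
  apply/imsetP/idP => [[p' p'q /inju->]|pq]; first by rewrite inE in p'q.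
  by exists p; rewrite ?inE.
by have /fin_all_exists[y yP] := ex; exists u, y => p q; apply: yP.
Qed.

Local Open Scope ring_scope.

(** * Orthogonality over the two-element field, and counting small subsets *)

Lemma spans_dot_eq0 (m : nat) (S : {set 'rV['F_2]_m}) (z : 'rV['F_2]_m) :
  spans S -> (forall v, v \in S -> dot z v = 0) -> z = 0.
Proof.
move=> spanS zS; apply/rowP=> j; rewrite mxE.
have dotE v : dot z v = (v *m z^T) 0 0.
  by rewrite mxE; apply: eq_bigr => k _; rewrite mxE mulrC.
(* The [j]-th unit vector is a combination of elements of [S], all orthogonal to [z]; pairing it
   with [z] reads off [z 0 j]. *)
have : delta_mx 0 j \in <<in_tuple (enum S)>>%VS by rewrite spanS memvf.
move/coord_span => eqv.
have <- : ((delta_mx 0 j : 'rV['F_2]_m) *m z^T) 0 0 = z 0 j by rewrite -rowE !mxE.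
rewrite eqv mulmx_suml summxE big1 // => i _.
rewrite -scalemxAl mxE -dotE zS ?mulr0 //.
by rewrite -mem_enum mem_nth // ltn_ord.
Qed.

Lemma dotBl (m : nat) (y z v : 'rV['F_2]_m) : dot (y - z) v = dot y v - dot z v.
Proof. by rewrite /dot -sumrB; apply: eq_bigr => j _; rewrite !mxE mulrBl. Qed.

Lemma F2_eqP (a b : 'F_2) : (a == 0) = (b == 0) -> a = b.
Proof. by move: a b; do 2 case=> [[|[|?]] ?] //=; move=> ?; apply/val_inj. Qed.

Lemma in_symdiff (T : finType) (A B : {set T}) x :
  (x \in symdiff A B) = ((x \in A) != (x \in B)).
Proof. by rewrite !inE; do 2 case: (x \in _). Qed.

Lemma card_small_sets (R : realType) (T : finType) (r : nat) :
  (0 < r)%N -> #|T| = (64 * r)%N ->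
  #|[set S : {set T} | (#|S| < r)%N]|%:R < (64 * expR 1) ^+ r :> R.
Proof.
(* Weight each subset [S] by [x ^ #|S|], where [x = r / #|T|]. *)
move=> r0 cardT; pose x : R := 1 / 64.
have x0 : 0 <= x by rewrite /x; lra.
have sumE : \sum_(S : {set T}) x ^+ #|S| = (x + 1) ^+ (64 * r).
  rewrite -cardT -prodr_const bigA_distr; apply: eq_bigr => S _.
  by rewrite -big_mkcond prodr_const.
have le_e : (x + 1) ^+ (64 * r) <= expR 1 ^+ r.
  rewrite exprM lerXn2r ?nnegrE ?exprn_ge0 ?expR_ge0 ?addr_ge0 //.
  have -> : expR 1 = expR (64%:R * x) :> R by congr expR; rewrite /x; lra.
  by rewrite expRM_natl lerXn2r ?nnegrE ?expR_ge0 ?addr_ge0 // addrC expR_ge1Dx.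
(* Since [x <= 1], each of the [N] sets has weight at least [x ^+ r.-1]. The exponent [r.-1] instead
   of [r] leaves a spare factor 64, which makes the bound strict. *)
set N := #|_|; suff N_le : N%:R * x ^+ r.-1 <= expR 1 ^+ r.
  have : N%:R <= 64 ^+ r.-1 * expR 1 ^+ r :> R.
    rewrite -ler_pdivrMl ?exprn_gt0 // -exprVn mulrC.
    by apply: le_trans N_le; rewrite /x mul1r.
  move/le_lt_trans; apply; rewrite exprMn ltr_pM2r ?exprn_gt0 ?expR_gt0 //.
  by rewrite ltr_eXn2l ?prednK //; lra.
rewrite (le_trans _ le_e) // -sumE /N mulr_natl -sumr_const.
rewrite [leRHS](bigID (mem [set S : {set T} | (#|S| < r)%N])) /=.
rewrite -[leLHS]addr0 lerD ?sumr_ge0 // => [|S _]; last by rewrite exprn_ge0.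
apply: ler_sum => S; rewrite inE => Sr.
rewrite ler_wiXn2l //; first by rewrite /x; lra.
by rewrite -ltnS prednK.
Qed.

(** * Distance from a single level set to a stable set *)

Section OneLevel.
Variables (D d r : nat) (xi : 'rV['F_2]_D -> 'rV['F_2]_d).
Hypotheses (card_pts : (2 ^ D = 8 * d)%N) (inj_xi : injective xi).
Hypothesis xi_spans : forall S : {set 'rV['F_2]_d},
  S \subset [set xi u | u : 'rV['F_2]_D] ->
  (3 * #|[set xi u | u : 'rV['F_2]_D]| <= 4 * #|S|)%N -> spans S.
Variable C : {set 'rV['F_2]_(D + d)}.
Hypothesis stableC : C \in stable _ r.

Let A : {set 'rV['F_2]_(D + d)} :=
  [set x | dot (rsubmx x) (xi (lsubmx x)) == 0].
Let err y : {set 'rV['F_2]_D} := [set u | row_mx u y \in symdiff A C].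
Let fibre y : {set 'rV['F_2]_D} := [set u | row_mx u y \in C].
Let good := [set y | (#|err y| < d)%N].

Let card_rV m : #|{: 'rV['F_2]_m}| = (2 ^ m)%N.
Proof. by rewrite card_mx card_Fp ?mul1n. Qed.

Let inA u y : (row_mx u y \in A) = (dot y (xi u) == 0).
Proof. by rewrite inE row_mxKl row_mxKr. Qed.

(* Two good fibres have fewer than [2 d] errors altogether, so [A] and [C] agree
   on both of them for more than [6 d] of the [8 d] values of the prefix. *)
Lemma good_fibre_inj : {in good &, injective fibre}.
Proof.
move=> y z; rewrite !inE => goody goodz eqyz; apply/subr0_eq.
pose V := ~: (err y :|: err z).
have cardV : (6 * d <= #|V|)%N.
  have := cardsC (err y :|: err z); rewrite card_rV card_pts -/V.
  by have := cardsU (err y) (err z); lia.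
apply: (@spans_dot_eq0 _ (xi @: V)) => [|_ /imsetP[u uV ->]].
  apply: xi_spans; first by apply/subsetP=> _ /imsetP[w _ ->]; apply: imset_f.
  (* Injectivity of [xi] carries the counts to the image, where [3 * (8 * d) = 4 * (6 * d)] meets
     the spanning threshold exactly. *)
  rewrite !card_imset // card_rV card_pts.
  by apply: leq_trans (leq_mul (leqnn 4) cardV); lia.
have agree w : u \notin err w -> (row_mx u w \in A) = (u \in fibre w).
  by rewrite [u \in err w]inE in_symdiff negbK [u \in fibre w]inE => /eqP.
move: uV; rewrite in_setC in_setU negb_or => /andP[/agree Ay /agree Az].
rewrite dotBl; apply/eqP; rewrite subr_eq0; apply/eqP/F2_eqP.
by rewrite -!inA Ay Az eqyz.
Qed.

Lemma card_good :
  (#|good| <= #|[set S : {set 'rV['F_2]_D} | (#|S| < r)%N]|)%N.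
Proof.
rewrite -(card_in_imset good_fibre_inj).
apply: leq_trans (card_leq_shattered _) _; apply: subset_leq_card.
apply/subsetP=> S shS; rewrite inE ltnNge; apply/negP=> rS.
have [u [y uy]] := shattered_half_graph rS shS.
move: stableC; rewrite inE => /has_ladderP[].
exists (fun p => row_mx (u p) 0), (fun q => row_mx 0 (y q)) => p q.
by rewrite add_row_mx addr0 add0r -uy inE.
Qed.

Lemma card_symdiff_lower : (d * (2 ^ d - #|good|) <= #|symdiff A C|)%N.
Proof.
have -> : #|symdiff A C| = (\sum_y #|err y|)%N.
  rewrite -sum1_card (reindex (fun p => row_mx p.1 p.2)) /=; last first.
    exists (fun x => (lsubmx x, rsubmx x)) => [[u y] _|x _] /=.
      by rewrite row_mxKl row_mxKr.
    exact: hsubmxK.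
  rewrite big_mkcond /= -(pair_bigA _ (fun u y =>
    if row_mx u y \in symdiff A C then 1%N else 0%N)) exchange_big /=.
  apply: eq_bigr => y _; rewrite -sum1_card -big_mkcond.
  by apply: eq_bigl => u; rewrite [RHS]inE.
(* With the symmetric difference sliced by [y], the good slices are dropped and every other slice
   has at least [d] points. *)
rewrite (bigID (mem good)) /= -card_rV -(cardsC good) addKn.
apply: leq_trans (leq_addl _ _).
rewrite mulnC -sum_nat_const; under eq_bigl do rewrite in_setC.
by apply: leq_sum => y; rewrite inE -leqNgt.
Qed.

Lemma stable_far (R : realType) : (0 < r)%N -> d = (8 * r)%N ->
  1 / 8 * (1 - (expR 1 / 4) ^+ r) <
  #|symdiff A C|%:R / #|{: 'rV['F_2]_(D + d)}|%:R :> R.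
Proof.
move=> r0 d8.
have card_pts_r : #|{: 'rV['F_2]_D}| = (64 * r)%N.
  by rewrite card_rV card_pts d8 mulnA.
have good_lt : #|good|%:R < (64 * expR 1) ^+ r :> R.
  apply: le_lt_trans (card_small_sets R r0 card_pts_r).
  by rewrite ler_nat card_good.
have good_le : (#|good| <= 2 ^ d)%N by rewrite -card_rV max_card.
have d0 : 0 < d%:R :> R by rewrite ltr0n d8 muln_gt0.
have P0 : 0 < (2 ^ d)%:R :> R by rewrite ltr0n expn_gt0.
have -> : #|{: 'rV['F_2]_(D + d)}|%:R = 8 * d%:R * (2 ^ d)%:R :> R.
  by rewrite card_rV expnD card_pts !natrM.
rewrite ltr_pdivlMr; last by rewrite !mulr_gt0.
move: card_symdiff_lower; rewrite -(ler_nat R) natrM natrB //.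
move/(lt_le_trans _); apply.
have -> : 1 / 8 * (1 - (expR 1 / 4) ^+ r) * (8 * d%:R * (2 ^ d)%:R) =
   d%:R * ((2 ^ d)%:R - (expR 1 / 4) ^+ r * (2 ^ d)%:R) :> R.
  by move: (_ ^+ r) => q; field.
rewrite ltr_pM2l // ltrD2l ltrN2; apply: lt_le_trans good_lt _.
(* As [d = 8 * r], the product of [(e / 4) ^ r] and [2 ^ d = 256 ^ r] is exactly the bound
   [(64 e) ^ r] on the good [y]. *)
have -> : (2 ^ d)%:R = 256 ^+ r :> R by rewrite d8 expnM natrX.
by rewrite -exprMn le_eqVlt; apply/orP; left; apply/eqP; congr (_ ^+ r); field.
Qed.

End OneLevel.

(** * Explicit decay of [(e / 4) ^ r] *)

Lemma expR1_div4 (R : realType) : expR 1 / 4 <= 4 / 5 :> R.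
Proof.
have e4 : expR 1 = expR (1 / 4) ^+ 4 :> R.
  by rewrite -expRM_natl; congr expR; lra.
(* From [exp (-1/4) >= 3/4] one gets [e <= (4/3) ^ 4 = 256/81 < 16/5]. *)
have [y0 ye] : 0 < expR (1 / 4) :> R /\ 3 / 4 * expR (1 / 4) <= 1 :> R.
  split; first exact: expR_gt0.
  rewrite -[leRHS](expRxMexpNx_1 (1 / 4 : R)) mulrC ler_wpM2l ?expR_ge0 //.
  by apply: le_trans (expR_ge1Dx _); lra.
have : expR (1 / 4) ^+ 4 <= (4 / 3) ^+ 4 :> R.
  by apply: lerXn2r; rewrite ?nnegrE; lra.
by rewrite -e4; lra.
Qed.

(** A Bernoulli-type bound: one more factor is at most [4/5], and [4/5 * (1 + (r + 1)/4) = 1 + r/5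
    <= 1 + r/4]. *)
Lemma expR1_div4X (R : realType) (r : nat) :
  (expR 1 / 4) ^+ r * (1 + r%:R / 4) <= 1 :> R.
Proof.
have q0 : 0 <= expR 1 / 4 :> R by rewrite divr_ge0 ?expR_ge0.
elim: r => [|r IHr]; first by rewrite expr0; lra.
rewrite exprSr -mulrA; apply: le_trans IHr; rewrite ler_wpM2l ?exprn_ge0 //.
rewrite -(@natr1 _ r); have r0 := ler0n R r; have e4 := expR1_div4 R.
by have := ler_wpM2r r0 e4; lra.
Qed.

(** * Growth of the block dimensions *)

Lemma hlm_d_top (t : nat) : (3 <= t)%N -> hlm_d t.+1 = (2 ^ (hlm_D t - 3))%N.
Proof. by rewrite hlm_dS; case: t => [|[|[|t]]]. Qed.

Lemma hlm_D_ge11 (t : nat) : (3 <= t)%N -> (11 <= hlm_D t)%N.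
Proof. exact: (@hlm_D_mono 3 t). Qed.

Lemma hlm_d_div8 (t : nat) : (3 <= t)%N ->
  hlm_d t.+1 = (8 * 2 ^ (hlm_D t - 6))%N.
Proof.
move=> t3; have := hlm_D_ge11 t3; rewrite hlm_d_top // -[8%N]/(2 ^ 3)%N -expnD.
by move=> D11; congr (2 ^ _)%N; lia.
Qed.

Lemma twr_le_hlm (t : nat) : (3 <= t)%N -> (twr t.-1 <= 2 ^ (hlm_D t - 6))%N.
Proof.
case: t => [|[|[|t]]] // _; elim: t => // t IHt.
have -> : hlm_D t.+4 = (hlm_D t.+3 + 8 * 2 ^ (hlm_D t.+3 - 6))%N.
  by rewrite -hlm_d_div8.
(* Compare exponents: the new block alone is at least 8 times the tower value of the induction
   hypothesis, and [D >= 11] absorbs the subtracted 6. *)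
have := @hlm_D_ge11 t.+3 isT; move: IHt; rewrite -!pred_Sn.
rewrite -[twr t.+3]/(2 ^ twr t.+2)%N leq_exp2l //.
move: (twr t.+2) (hlm_D t.+3) (2 ^ _)%N => *; lia.
Qed.

Lemma ltn_twr (m : nat) : (m < twr m)%N.
Proof. by elim: m => // m IHm; apply: leq_ltn_trans IHm (ltn_expl _ _). Qed.

(** * Reduction of the top level to a single level, and the deduction *)

Lemma segment_rsubmx (m n : nat) (x : 'rV['F_2]_(m + n)) :
  segment x m n = rsubmx x.
Proof.
apply/rowP=> j; rewrite (segmentE _ (_ : m + j < m + n)%N) ?ltn_add2l // => ?.
by rewrite mxE; congr (x 0 _); apply: val_inj.
Qed.

Lemma segment_lsubmx (m n : nat) (x : 'rV['F_2]_(m + n)) :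
  segment x 0 m = lsubmx x.
Proof.
apply/rowP=> j; rewrite (segmentE _ (_ : 0 + j < m + n)%N) => [|?].
  by rewrite (leq_trans (ltn_ord j)) ?leq_addr.
by rewrite mxE; congr (x 0 _); apply: val_inj.
Qed.

(** [hlm_D t.+1] unfolds to [hlm_D t + hlm_d t.+1], so a vector is exactly its prefix followed by
    its top block. *)
Lemma level_setE (t : nat) (xi : hlm_maps) :
  level_set t.+1 xi t.+1 =
  [set x : 'rV['F_2]_(hlm_D t + hlm_d t.+1) |
     dot (rsubmx x) (xi t.+1 (lsubmx x)) == 0].
Proof.
apply/setP=> x.
by rewrite !inE /block /Defs.prefix segment_rsubmx segment_lsubmx.
Qed.

Lemma stable_symdiff_lower (R : realType) (t : nat) (xi : hlm_maps)
    (C : {set 'rV['F_2]_(hlm_D t.+1)}) :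
  (3 <= t)%N -> admissible t.+1 xi -> C \in stable _ (hlm_d t.+1 %/ 8) ->
  1 / 8 * (1 - (expR 1 / 4) ^+ (hlm_d t.+1 %/ 8)) <
  #|symdiff (level_set t.+1 xi t.+1) C|%:R / #|{: 'rV['F_2]_(hlm_D t.+1)}|%:R :> R.
Proof.
move=> t3 adm; have [|_ _ inj_xi _ /(_ t3) spans_xi] := adm t.+1; first by rewrite leqnn.
move=> stableC; have d8 := hlm_d_div8 t3.
have rE : (hlm_d t.+1 %/ 8 = 2 ^ (hlm_D t - 6))%N by rewrite d8 mulKn.
have pts : (2 ^ hlm_D t = 8 * hlm_d t.+1)%N.
  rewrite hlm_d_top // -[8%N]/(2 ^ 3)%N -expnD subnKC //.
  exact: leq_trans (hlm_D_ge11 t3).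
rewrite level_setE; apply: (stable_far pts inj_xi spans_xi stableC).
  by rewrite rE expn_gt0.
by rewrite rE.
Qed.

(** If [symdiff A B] had no ladder of length [r], it would be an [r]-stable set differing from [A]
    precisely on [B], hence too close to [A]. *)
Lemma leq_ldr_star (G : finZmodType) (R : realType) (eta : R) (A : {set G})
    (r : nat) : 0 <= eta ->
  (forall C, C \in stable _ r -> eta < #|symdiff A C|%:R / #|G|%:R) ->
  (r <= ldr_star eta A)%N.
Proof.
move=> eta0 far; have [[B cardB ->] _] := ldr_star_min A eta0.
apply: leq_ldr; apply: contraT => nladder.
have := far (symdiff A B); rewrite inE => /(_ nladder).
have -> : symdiff A (symdiff A B) = B.
  by apply/setP=> x; rewrite !in_symdiff; do 2 case: (x \in _).
rewrite ltr_pdivlMr; first by rewrite ltNge cardB.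
rewrite ltr0n.
by apply/card_gt0P; exists 0.
Qed.

Lemma floor_ge16 (R : realType) (eps : R) (s : nat) :
  0 < eps -> eps <= 1 / 256 -> s%:Z = Num.floor (1 / (16 * eps)) -> (16 <= s)%N.
Proof.
move=> eps0 eps_le sE; rewrite -lez_nat sE floor_ge_int.
by rewrite ler_pdivlMr; lra.
Qed.

(** Put [q = (e / 4) ^ r]. The decay bound gives [q * r <= 4], whereas [q >= 1 - 8 * eta] would
    force [q * r > 4]. *)
Lemma lt_radius (R : realType) (eta : R) (r : nat) :
  eta < 1 / 8 -> 4 < (1 - 8 * eta) * r%:R ->
  eta < 1 / 8 * (1 - (expR 1 / 4) ^+ r).
Proof.
move=> eta8 r_lt; have := expR1_div4X R r; have := ler0n R r.
have : 0 <= (expR 1 / 4 : R) ^+ r by rewrite exprn_ge0 // divr_ge0 ?expR_ge0.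
move: (_ ^+ r) r%:R r_lt => q k; nra.
Qed.

Theorem theorem4p2 (R : realType) :
  (forall (eps : R) (s : nat) (xi : hlm_maps),
     0 < eps -> eps <= 1 / 256 ->
     s%:Z = Num.floor (1 / (16 * eps)) ->
     admissible s xi ->
     let d := hlm_d s in
     let r := (d %/ 8)%N in
     let A := level_set s xi s in
     [/\ (8 %| d)%N,
         1 / 8 * (1 - (expR 1 / 4) ^+ r) < dist R A (stable _ r),
         1 / 16 < 1 / 8 * (1 - (expR 1 / 4) ^+ r) :> R,
         forall eta : R, 0 <= eta -> eta <= 1 / 16 ->
           (d %/ 8 <= ldr_star eta A)%N
       & (twr (s - 2) <= d %/ 8)%N /\
         1 / 16 * (ln #|{: 'rV['F_2]_(hlm_D s)}|%:R / ln 2) <= d%:R / 8 :> R])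
  /\
  (forall eta : R, 0 <= eta -> eta < 1 / 8 ->
   exists s0 : nat,
   forall (eps : R) (s : nat) (xi : hlm_maps),
     0 < eps -> eps <= 1 / 256 ->
     s%:Z = Num.floor (1 / (16 * eps)) ->
     admissible s xi ->
     (s0 <= s)%N ->
     (hlm_d s %/ 8 <= ldr_star eta (level_set s xi s))%N).
Proof.
split=> [eps s xi eps0 eps_le sE adm|eta eta0 eta8].
  have s16 := floor_ge16 eps0 eps_le sE; case: s s16 {sE} adm => // t t15 adm d r A.
  have t3 : (3 <= t)%N by rewrite -ltnS (leq_trans _ t15).
  have rE : r = (2 ^ (hlm_D t - 6))%N by rewrite /r /d hlm_d_div8 // mulKn.
  have dE : d = (8 * r)%N by rewrite /d hlm_d_div8 // rE.
  have twr_r : (twr t.-1 <= r)%N by rewrite rE twr_le_hlm.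
  (* [s >= 16] gives [t.-1 >= 14], and [twr] exceeds its argument. At [eta = 1/16] the radius bound
     asks only for [r > 8]. *)
  have r14 : (14 < r)%N.
    by apply: leq_trans twr_r; apply: leq_ltn_trans (ltn_twr _); lia.
  have radius : 1 / 16 < 1 / 8 * (1 - (expR 1 / 4) ^+ r) :> R.
    apply: lt_radius; first by lra.
    by move: r14; rewrite -(ltr_nat R); lra.
  have far C : C \in stable _ r ->
      1 / 8 * (1 - (expR 1 / 4) ^+ r) <
      #|symdiff A C|%:R / #|{: 'rV['F_2]_(hlm_D t.+1)}|%:R :> R.
    exact: stable_symdiff_lower.
  split=> //.
  - by rewrite dE dvdn_mulr.
  (* Nonemptiness excludes the default value of [dist]; [set0] is [r]-stable because [r > 0]. *)
  - have nonempty : stable 'rV['F_2]_(hlm_D t.+1) r != set0.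
      by apply/set0Pn; exists set0; apply: set0_stable; lia.
    by have [[C CF ->] _] := dist_min R A nonempty; apply: far.
  - move=> eta eta0 eta_le; apply: leq_ldr_star => // C /far.
    by apply: le_lt_trans; apply: le_trans eta_le _; apply: ltW.
  split; first by rewrite subSS subn1.
  have -> : ln #|{: 'rV['F_2]_(hlm_D t.+1)}|%:R = (hlm_D t.+1)%:R * ln 2 :> R.
    by rewrite card_mx card_Fp // mul1n natrX lnXn // mulr_natl.
  rewrite mulfK ?gt_eqF ?ln_gt0 ?ltr1n //.
  (* With [n = D_t - 6], [n < 2 ^ n] gives [D_t = n + 6 <= 8 * 2 ^ n = d], so
     [D_s = D_t + d <= 2 * d]. *)
  have D_le : (hlm_D t.+1 <= 2 * d)%N.
    rewrite /= -/(hlm_d t.+1) -/d mul2n -addnn leq_add2r.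
    have := hlm_D_ge11 t3; rewrite dE rE.
    by have := ltn_expl (hlm_D t - 6) (isT : (1 < 2)%N); lia.
  by move: D_le; rewrite -(ler_nat R) natrM; lra.
have [N NP] : exists N : nat, 4 < (1 - 8 * eta) * N%:R.
  exists (Num.bound (4 / (1 - 8 * eta))).
  have e0 : 0 < 1 - 8 * eta by lra.
  rewrite mulrC -ltr_pdivrMr //; apply: archi_boundP.
  by rewrite divr_ge0 // ltW.
(* For [s = t.+1 >= N.+2] one has [N <= t.-1 < twr t.-1 <= r]. *)
exists N.+2 => eps s xi eps0 eps_le sE adm sN.
have s16 := floor_ge16 eps0 eps_le sE; case: s s16 {sE} adm sN => // t t15 adm tN.
have t3 : (3 <= t)%N by rewrite -ltnS (leq_trans _ t15).
apply: leq_ldr_star => // C stableC.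
apply: lt_trans (stable_symdiff_lower R t3 adm stableC).
apply: lt_radius => //; apply: lt_le_trans NP _.
rewrite ler_wpM2l ?ler_nat //; first by lra.
rewrite hlm_d_div8 // mulKn //.
apply: leq_trans (twr_le_hlm t3).
by apply: leq_trans (ltnW (ltn_twr _)); lia.
Qed.
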